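(* For each integer $n\ge 1$, let $\bar X=\bar X_n=\frac1{2n}\sum_{k=1}^{2n}X_k$ be the average value of the sockuence of a uniformly random matching on $[2n]$. Then for every $n\ge1$, $$\mathbb{E}\,\bar X=\frac{2n+1}{6}.$$ Moreover, for every function $\omega$ with $\omega(n)\to\infty$ as $n\to\infty$, $$\lim_{n\to\infty}\mathbb{P}\left(\left|\bar X-\frac n3\right|\le\omega(n)\sqrt n\right)=1.$$
   Context: $[m]=\{1,2,\dots,m\}$. A matching on $[2n]$ (an ordered matching of size $n$) is a partition of $[2n]$ into $n$ two-element subsets, called edges. There are $\frac{(2n)!}{2^n n!}$ of them. For a matching $M$ on $[2n]$ and $k\in[2n]$, let $x_k(M)$ be the number of edges of $M$ with one endpoint in $[k]$ and the other in $[2n]\setminus[k]$ (in particular $x_{2n}(M)=0$). The sequence $(x_k(M))_{k=1}^{2n}$ is called the sockuence of $M$. Let $\mathbf{M}_n$ be a matching chosen uniformly at random from all matchings on $[2n]$, and let $X_k=x_k(\mathbf{M}_n)$ for $k\in[2n]$. *)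

(* Defs.v *)
From HB Require Import structures.
From mathcomp Require Import all_boot all_order all_algebra.
From mathcomp Require Import all_classical all_reals all_analysis.

Set Implicit Arguments.
Unset Strict Implicit.
Unset Printing Implicit Defensive.

Import Order.TTheory GRing.Theory Num.Theory.
Import numFieldNormedType.Exports.

Local Open Scope ring_scope.

(* The ordinal i : 'I_n.*2 stands for the point i + 1 of [2n], so that the
   initial segment [k] = {1, ..., k} is the set of ordinals i with i < k. *)
Definition initial_segment (n k : nat) : {set 'I_n.*2} :=
  [set i : 'I_n.*2 | (i < k)%N]%SET.

Definition is_matching (n : nat) (M : {set {set 'I_n.*2}}) : bool :=
  [&& finset.partition M [set: 'I_n.*2]%SET, #|M| == n
    & [forall e in M, #|e : {set 'I_n.*2}| == 2%N]].

Definition matchings (n : nat) : {set {set {set 'I_n.*2}}} :=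
  [set M | is_matching M]%SET.

Definition sockuence (n : nat) (M : {set {set 'I_n.*2}}) (k : nat) : nat :=
  #|[set e in M | [exists i in e, exists j in e,
      (i \in initial_segment n k) && (j \notin initial_segment n k)]]%SET|.

Definition sockuence_average (R : realType) (n : nat)
    (M : {set {set 'I_n.*2}}) : R :=
  (\sum_(1 <= k < n.*2.+1) (sockuence M k)%:R) / (n.*2)%:R.

Definition matching_prob (R : realType) (n : nat)
    (A : pred {set {set 'I_n.*2}}) : R :=
  #|[set M in matchings n | A M]%SET|%:R / #|matchings n|%:R.

Definition matching_expectation (R : realType) (n : nat)
    (f : {set {set 'I_n.*2}} -> R) : R :=
  (\sum_(M in matchings n) f M) / #|matchings n|%:R.

(* Main.v *)
Require Import Defs.
From HB Require Import structures.
From mathcomp Require Import all_boot all_order all_algebra all_fingroup.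
From mathcomp Require Import zify ring lra.
From mathcomp Require Import all_classical all_reals all_analysis.

(* Summing the sockuence counts every edge {i < j} once for each k in (i, j],
   so it gives the total length L of the edges. By symmetry under
   transpositions, a given pair is an edge of a random matching with
   probability 1/(2n-1), and two given disjoint pairs are both edges with
   probability 1/((2n-1)(2n-3)); intersecting distinct pairs never are. The
   first fact yields E L; bounding the joint probability for distinct
   pairs by the disjoint case, the second yields
     E L^2 <= S^2/((2n-1)(2n-3)) + 2n S/(2n-1),  S = C(2n+1, 3),
   whence E(L/2n - n/3)^2 <= 2n, and Chebyshev's inequality concludes. *)

Set Implicit Arguments.
Unset Strict Implicit.
Unset Printing Implicit Defensive.

Import Order.TTheory GRing.Theory Num.Theory.
Import numFieldNormedType.Exports.

Local Open Scope nat_scope.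

(** * Edges of a matching and relabelling of points *)

Lemma matching_block_eq n (M : {set {set 'I_n.*2}}) (e f : {set 'I_n.*2}) x :
  M \in matchings n -> e \in M -> f \in M -> x \in e -> x \in f -> e = f.
Proof.
rewrite inE => /and3P[/partition_trivIset tiM _ _] eM fM xe xf.
by rewrite -(def_pblock tiM eM xe) (def_pblock tiM fM xf).
Qed.

Lemma matching_mate n (M : {set {set 'I_n.*2}}) x :
  M \in matchings n -> exists2 y, y != x & [set x; y]%SET \in M.
Proof.
rewrite inE => /and3P[/finset.cover_partition covM _ /forall_inP M2].
have xM : x \in finset.cover M by rewrite covM inE.
have := M2 _ (pblock_mem xM); move=> /cards2P[y [z [yz E]]].
have := pblock_mem xM; rewrite E => eM.
move: xM; rewrite -mem_pblock E !inE => /orP[] /eqP xE.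
  by exists z; rewrite xE // eq_sym.
by exists y; rewrite xE // finset.setUC.
Qed.

Lemma edge_neq n (M : {set {set 'I_n.*2}}) x y :
  M \in matchings n -> [set x; y]%SET \in M -> x != y.
Proof.
rewrite inE => /and3P[_ _ /forall_inP M2] /M2.
by rewrite cards2; case: (x != y).
Qed.

Lemma imset_matching n (s : {perm 'I_n.*2}) (M : {set {set 'I_n.*2}}) :
  M \in matchings n ->
  ((fun e : {set 'I_n.*2} => s @: e) @: M)%SET \in matchings n.
Proof.
rewrite !inE => /and3P[pM cM /forall_inP M2]; apply/and3P; split.
- have -> : [set: 'I_n.*2]%SET = (s @: [set: 'I_n.*2])%SET.
    apply/esym/eqP; rewrite eqEcard finset.subsetT /=.
    by rewrite card_imset //; apply: perm_inj.
  by rewrite imset_partition //; apply: perm_inj.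
- by rewrite card_imset //; apply: imset_inj; apply: perm_inj.
- apply/forall_inP => e /imsetP[f fM ->].
  by rewrite card_imset ?M2 //; apply: perm_inj.
Qed.

(** * Counting matchings that contain prescribed edges *)

Definition matchings_with n (E : {set {set 'I_n.*2}}) :=
  [set M in matchings n | E \subset M]%SET.

Lemma imset_tperm_id n (x y : 'I_n.*2) (e : {set 'I_n.*2}) :
  x \notin e -> y \notin e -> (tperm x y @: e)%SET = e.
Proof.
move=> xe ye; rewrite -[RHS]imset_id; apply: eq_in_imset => z ze /=.
by rewrite tpermD //; apply/eqP => E; move: xe ye; rewrite E ze.
Qed.

(** Relabelling by the transposition of [y] and [y'] is injective, preserves matchings, fixes [x]
    and every edge of [E], and sends {x, y} to {x, y'}. Used in both directions it shows that the
    two counts agree. *)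
Lemma card_matchings_with_le n (E : {set {set 'I_n.*2}}) x y y' :
  x != y -> x != y' -> y \notin finset.cover E -> y' \notin finset.cover E ->
  #|matchings_with ([set x; y] |: E)%SET|
    <= #|matchings_with ([set x; y'] |: E)%SET|.
Proof.
move=> xy xy' yE y'E.
pose s := fun M : {set {set 'I_n.*2}} =>
  ((fun e : {set 'I_n.*2} => tperm y y' @: e) @: M)%SET.
have s_inj : injective s.
  by apply: imset_inj; apply: imset_inj; apply: perm_inj.
rewrite -(card_imset _ s_inj); apply: subset_leq_card.
apply/fintype.subsetP => _ /imsetP[M M_with ->].
move: M_with; rewrite inE finset.subUset finset.sub1set => /and3P[Mm xyM EM].
rewrite inE imset_matching //= finset.subUset finset.sub1set; apply/andP; split.
  apply/imsetP; exists [set x; y]%SET => //.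
  by rewrite imsetU1 imset_set1 tpermL tpermD // eq_sym.
apply/fintype.subsetP => e eE; apply/imsetP; exists e.
  exact: (fintype.subsetP EM).
have sub : e \subset finset.cover E by apply: finset.bigcup_sup eE.
by rewrite imset_tperm_id //; [move: yE | move: y'E];
  apply: contraNN; apply: (fintype.subsetP sub).
Qed.

(* Every matching gives [x] exactly one partner outside [cover E], and the
   transpositions fixing [x] and [cover E] make all these partners equally
   frequent. *)
Lemma card_matchings_with_setU1 n (E : {set {set 'I_n.*2}}) x y :
  x != y -> x \notin finset.cover E -> y \notin finset.cover E ->
  #|matchings_with E|
    = (n.*2 - #|finset.cover E| - 1) * #|matchings_with ([set x; y] |: E)%SET|.
Proof.
move=> xy xE yE.
pose D := (~: (x |: finset.cover E))%SET.
have cardD : #|D| = n.*2 - #|finset.cover E| - 1.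
  have := cardsC (x |: finset.cover E)%SET; rewrite cardsU1 xE card_ord /D; lia.
have -> : #|matchings_with E|
    = \sum_(z in D) #|matchings_with ([set x; z] |: E)%SET|.
  transitivity (\sum_(M in matchings_with E)
      \sum_(z in D) ([set x; z]%SET \in M : nat)).
    rewrite -sum1_card; apply: eq_bigr => M; rewrite inE => /andP[Mm EM].
    have [z zx xzM] := matching_mate x Mm.
    (* An edge of [E] through the mate [z] would have to be {x, z}, and [cover E] would then contain
       [x]. *)
    have zD : z \in D.
      rewrite !inE negb_or zx; apply/finset.bigcupP => -[e eE ze].
      have ee : e = [set x; z]%SET.
        apply: (matching_block_eq Mm _ xzM ze); first exact: (fintype.subsetP EM).
        by rewrite !inE eqxx orbT.
      move/negP: xE; apply; apply/finset.bigcupP; exists e => //.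
      by rewrite ee !inE eqxx.
    rewrite (bigD1 z) //= xzM big1 ?addn0 // => w /andP[_ wz].
    case: (boolP (_ \in M)) => // xwM.
    have /setP/(_ w) : [set x; w]%SET = [set x; z]%SET.
      by apply: (matching_block_eq (x := x) Mm) => //; rewrite !inE eqxx.
    rewrite !inE eqxx orbT (negPf wz) orbF => /esym/eqP wx.
    by move: (edge_neq Mm xwM); rewrite wx eqxx.
  rewrite exchange_big /=; apply: eq_bigr => z _.
  rewrite -sum1_card big_mkcond [RHS]big_mkcond /=; apply: eq_bigr => M _.
  rewrite !inE finset.subUset finset.sub1set.
  by case: (is_matching M); case: (E \subset M); case: (_ \in M).
rewrite -cardD -sum_nat_const; apply: eq_bigr => z.
rewrite !inE negb_or => /andP[zx zE].
by apply/eqP; rewrite eqn_leq !card_matchings_with_le // eq_sym.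
Qed.

Lemma matchings_with0 n : matchings_with (n := n) finset.set0 = matchings n.
Proof. by apply/setP => M; rewrite !inE finset.sub0set andbT. Qed.

Lemma card_matchings_edge n (x y : 'I_n.*2) : x != y ->
  #|matchings n| = (n.*2 - 1) * #|matchings_with [set [set x; y]]%SET|.
Proof.
move=> xy; rewrite -matchings_with0 (card_matchings_with_setU1 xy) /finset.cover;
  by rewrite ?big_set0 ?inE // cards0 subn0 finset.setU0.
Qed.

(** The first edge covers two points and [z] is not its own partner, which leaves 2n - 3 candidates
    for the partner of [z]. *)
Lemma card_matchings_edge2 n (x y z t : 'I_n.*2) :
  x != y -> z != t -> [disjoint [set x; y] & [set z; t]] ->
  #|matchings_with [set [set x; y]]%SET|
  = (n.*2 - 3) * #|matchings_with [set [set z; t]; [set x; y]]%SET|.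
Proof.
move=> xy zt dis.
have cov : finset.cover [set [set x; y]]%SET = [set x; y]%SET.
  by rewrite /finset.cover big_set1.
rewrite (card_matchings_with_setU1 zt) cov.
- by rewrite cards2 xy -subnDA.
- by apply/negP => /(disjointFr dis); rewrite !inE eqxx.
- by apply/negP => /(disjointFr dis); rewrite !inE eqxx orbT.
Qed.

(** Makes division by the number of matchings legitimate. The witness groups ordinals by their half,
    pairing 2k with 2k + 1. *)
Lemma matchings_gt0 n : 0 < #|matchings n|.
Proof.
apply/card_gt0P.
pose P := preim_partition (fun i : 'I_n.*2 => i./2) [set: 'I_n.*2]%SET.
have pP : finset.partition P [set: 'I_n.*2]%SET by apply: preim_partitionP.
have P2 e : e \in P -> #|e| = 2.
  case/imsetP => i _ ->.
  have lt0 : i./2.*2 < n.*2 by have := ltn_ord i; lia.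
  have lt1 : i./2.*2.+1 < n.*2 by have := ltn_ord i; lia.
  have -> : [set y in [set: 'I_n.*2] | i./2 == y./2]%SET
      = [set Ordinal lt0; Ordinal lt1]%SET.
    apply/setP => j; rewrite !inE -!val_eqE /=.
    by rewrite !(eq_sym (nat_of_ord j)); apply/idP/idP; lia.
  by rewrite cards2 -val_eqE /=; lia.
exists P; rewrite inE /is_matching pP /=; apply/andP; split; last first.
  by apply/forall_inP => e /P2 ->.
have := card_uniform_partition P2 pP; rewrite cardsT card_ord => /eqP.
by rewrite -[X in X == _]muln2 eqn_pmul2r // eq_sym.
Qed.

(** * The sum of the sockuence as the total edge length *)

(** Coding edges by ordered pairs turns sums over edges into sums over a product type. Each edge has
    a single increasing code; the other pairs will carry weight zero. *)
Definition pair_edge n (p : 'I_n.*2 * 'I_n.*2) : {set 'I_n.*2} :=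
  [set p.1; p.2]%SET.

Lemma pair_edge_inj n (p q : 'I_n.*2 * 'I_n.*2) :
  p.1 < p.2 -> q.1 < q.2 -> pair_edge p = pair_edge q -> p = q.
Proof.
case: p q => [a b] [c d] /= ab cd E.
have : a \in [set c; d]%SET by rewrite -[[set c; d]%SET]E !inE eqxx.
have : b \in [set c; d]%SET by rewrite -[[set c; d]%SET]E !inE eqxx orbT.
by rewrite !inE => /orP[] /eqP bE /orP[] /eqP aE; subst => //; lia.
Qed.

(** The ordinal [i] is the point i + 1, so it lies in [k] when [i < k], and [j] lies outside when
    [k <= j]. Together these force [i < j], so a crossing edge is counted only once. *)
Lemma sockuenceE n (M : {set {set 'I_n.*2}}) k : M \in matchings n ->
  sockuence M k
  = \sum_(i < n.*2) \sum_(j < n.*2)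
      (i < k <= j) * ([set i; j]%SET \in M).
Proof.
move=> Mm.
pose A := [set p : 'I_n.*2 * 'I_n.*2
            | (p.1 < k <= p.2) && (pair_edge p \in M)]%SET.
rewrite pair_big /=.
transitivity #|A|; last first.
  rewrite -sum1_card big_mkcond /=; apply: eq_bigr => p _.
  by rewrite inE; case: (_ <= _ <= _); case: (_ \in M).
have inj : {in A &, injective (@pair_edge n)}.
  move=> p q; rewrite !inE => /andP[/andP[pk kp] _] /andP[/andP[qk kq] _].
  by apply: pair_edge_inj; [apply: leq_trans kp | apply: leq_trans kq].
rewrite -(card_in_imset inj); apply: eq_card => e; rewrite inE.
apply/andP/imsetP => [[eM /exists_inP[i ie /exists_inP[j je]]]|].
  rewrite !inE -leqNgt => /andP[ik kj].
  have [y yi iyM] := matching_mate i Mm.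
  have eE : e = [set i; y]%SET.
    by apply: (matching_block_eq Mm eM iyM ie); rewrite !inE eqxx.
  have yj : y = j.
    by move: je; rewrite eE !inE => /orP[] /eqP jE //; move: kj; rewrite jE; lia.
  by subst y; exists (i, j); rewrite ?inE //= ik kj iyM.
move=> [[i j]]; rewrite !inE /= => /andP[/andP[ik kj] ijM] ->; split=> //.
apply/exists_inP; exists i; first by rewrite !inE eqxx.
apply/exists_inP; exists j; first by rewrite !inE eqxx orbT.
by rewrite !inE ik -leqNgt.
Qed.

Lemma sum_interval_indicator (N i j : nat) : j <= N ->
  \sum_(1 <= k < N.+1) (i < k <= j : nat) = j - i.
Proof.
move=> jN; elim: N j jN => [|N IH] j jN.
  by rewrite big_geq //; lia.
rewrite big_nat_recr //=; have [jN'|jN'] := leqP j N.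
  by rewrite IH //; lia.
have -> : j = N.+1 by lia.
(* For k up to [N] the upper bound can be lowered from [N.+1] to [N], and induction applies with
   [j = N]. *)
under eq_big_nat => k kN do
  have -> : (i < k <= N.+1) = (i < k <= N) by [lia].
by rewrite IH //; lia.
Qed.

(** Truncated subtraction kills the pairs with [j <= i], so each edge contributes its length
    once. *)
Definition total_length n (M : {set {set 'I_n.*2}}) :=
  \sum_(i < n.*2) \sum_(j < n.*2) (j - i) * ([set i; j]%SET \in M).

Lemma sum_sockuence n (M : {set {set 'I_n.*2}}) : M \in matchings n ->
  \sum_(1 <= k < n.*2.+1) sockuence M k = total_length M.
Proof.
move=> Mm; under eq_bigr => k _ do rewrite sockuenceE //.
rewrite exchange_big; apply: eq_bigr => i _ /=.
rewrite exchange_big; apply: eq_bigr => j _ /=.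
by rewrite -big_distrl /= sum_interval_indicator // ltnW.
Qed.

(** * Closed forms for sums of distances *)

Lemma sum_rev_sub N : \sum_(i < N) (N - i) = 'C(N.+1, 2).
Proof.
rewrite -(@bin2_sum N.+1) big_mkord big_ord_recl add0n.
rewrite (reindex_inj rev_ord_inj) /=; apply: eq_bigr => i _.
by rewrite /= /bump leq0n; have := ltn_ord i; lia.
Qed.

(** A new last point adds only its distances to the earlier points, C(N+1, 2) in all, and Pascal's
    rule closes the induction. *)
Lemma sum_distances N : \sum_(i < N) \sum_(j < N) (j - i) = 'C(N.+1, 3).
Proof.
elim: N => [|N IH]; first by rewrite big_ord0.
rewrite big_ord_recr /= [X in _ + X]big1 ?addn0; last first.
  by move=> j _; have := ltn_ord j; lia.
under eq_bigr => i _ do rewrite big_ord_recr /=.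
by rewrite big_split /= IH sum_rev_sub -binS.
Qed.

Lemma mul6_bin3 N : 6 * 'C(N.+1, 3) = N.-1 * N * N.+1.
Proof.
have := bin_ffact N.+1 3; rewrite !ffactnS ffactn0 /=.
by rewrite muln1 mulnC => ->; lia.
Qed.

(** * First and second moments of the total length, by counting *)

Lemma total_lengthE n (M : {set {set 'I_n.*2}}) :
  total_length M
  = \sum_(p : 'I_n.*2 * 'I_n.*2) (p.2 - p.1) * (pair_edge p \in M).
Proof. by rewrite /total_length pair_big. Qed.

Lemma sum_pair_distances N :
  \sum_(p : 'I_N * 'I_N) (p.2 - p.1) = 'C(N.+1, 3).
Proof. by rewrite -sum_distances pair_big. Qed.

(** This is E L = S/(2n-1) with denominators cleared, so that the counting stays in [nat]. *)
Lemma sum_total_length n :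
  (n.*2 - 1) * (\sum_(M in matchings n) total_length M)
  = #|matchings n| * 'C(n.*2.+1, 3).
Proof.
under eq_bigr => M _ do rewrite total_lengthE.
rewrite exchange_big -sum_pair_distances !big_distrr; apply: eq_bigr => p _ /=.
rewrite -big_distrr /=.
have [p_le|p_lt] := leqP p.2 p.1.
  by rewrite (eqP p_le) mul0n !muln0.
have p_neq : p.1 != p.2 by apply: contraTneq p_lt => ->; rewrite ltnn.
rewrite (card_matchings_edge p_neq) mulnCA mulnC; congr (_ * _ * _).
rewrite -sum1_card big_mkcond [RHS]big_mkcond; apply: eq_bigr => M _.
by rewrite !inE finset.sub1set; case: (is_matching M); case: (_ \in M).
Qed.

(** One bound covers three cases: equal pairs, where the summand 1 is slack; disjoint pairs, where
    equality holds; and distinct intersecting pairs, where the left side vanishes. *)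
Lemma sum_two_edges_le n (p q : 'I_n.*2 * 'I_n.*2) :
  p.1 < p.2 -> q.1 < q.2 ->
  (n.*2 - 1) * (n.*2 - 3)
    * (\sum_(M in matchings n) (pair_edge p \in M) * (pair_edge q \in M))
  <= #|matchings n| * (1 + (n.*2 - 3) * (q == p)).
Proof.
move=> p_lt q_lt.
have p_neq : p.1 != p.2 by apply: contraTneq p_lt => ->; rewrite ltnn.
have q_neq : q.1 != q.2 by apply: contraTneq q_lt => ->; rewrite ltnn.
have sumE : \sum_(M in matchings n) (pair_edge p \in M) * (pair_edge q \in M)
    = #|matchings_with [set pair_edge q; pair_edge p]%SET|.
  rewrite -sum1_card big_mkcond [RHS]big_mkcond; apply: eq_bigr => M _.
  rewrite !inE finset.subUset !finset.sub1set.
  by case: (is_matching M); case: (pair_edge p \in M); case: (pair_edge q \in M).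
rewrite sumE.
have [->|qp] := eqVneq q p.
  rewrite finset.setUid (card_matchings_edge p_neq) -/(pair_edge p) muln1.
  by rewrite mulnAC leq_mul // leq_addl.
rewrite muln0 addn0 muln1.
have [dis|] := boolP [disjoint pair_edge p & pair_edge q].
  rewrite (card_matchings_edge p_neq) (card_matchings_edge2 p_neq q_neq dis).
  by rewrite mulnA.
case/pred0Pn => x /= /andP[xp xq].
rewrite (_ : matchings_with _ = finset.set0) ?cards0 ?muln0 //.
apply/setP => M; rewrite inE finset.in_set0 finset.subUset !finset.sub1set.
apply/negP => /and3P[Mm qM pM].
have := matching_block_eq Mm qM pM xq xp.
by move/(pair_edge_inj q_lt p_lt) => E; rewrite E eqxx in qp.
Qed.

Lemma sum_total_length_sqr_le n :
  (n.*2 - 1) * (n.*2 - 3) * (\sum_(M in matchings n) total_length M ^ 2)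
  <= #|matchings n|
     * ('C(n.*2.+1, 3) ^ 2 + (n.*2 - 3) * (n.*2 * 'C(n.*2.+1, 3))).
Proof.
set N := n.*2; set m := #|matchings n|.
pose d (p : 'I_N * 'I_N) := p.2 - p.1.
have -> : \sum_(M in matchings n) total_length M ^ 2
  = \sum_p \sum_q (d p * d q) *
      (\sum_(M in matchings n) (pair_edge p \in M) * (pair_edge q \in M)).
  under eq_bigr => M _ do rewrite total_lengthE -mulnn big_distrlr /=.
  rewrite exchange_big; apply: eq_bigr => p _ /=.
  rewrite exchange_big; apply: eq_bigr => q _ /=.
  by rewrite big_distrr /=; apply: eq_bigr => M _; rewrite mulnACA.
have -> : 'C(N.+1, 3) ^ 2 = \sum_p \sum_q d p * d q.
  by rewrite -mulnn -sum_pair_distances big_distrlr.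
rewrite -sum_pair_distances.
(* The diagonal sum of [d p * d p] is at most 2n S, since every distance is at most 2n. *)
apply: (@leq_trans (m * (\sum_p \sum_q (d p * d q)
                     + (N - 3) * \sum_p d p * d p))); last first.
  rewrite leq_mul2l leq_add2l !leq_mul2l big_distrr /=.
  apply/orP; right; apply/orP; right; apply: leq_sum => p _.
  by rewrite leq_mul2r /d; have := ltn_ord p.2; lia.
rewrite [in X in _ <= m * (_ + X)]big_distrr -big_split !big_distrr /=.
apply: leq_sum => p _.
apply: (@leq_trans (\sum_q d p * d q * (m * (1 + (N - 3) * (q == p))))).
  rewrite big_distrr /=; apply: leq_sum => q _.
  rewrite mulnCA; have [p_le|p_lt] := leqP p.2 p.1.
    by rewrite /d (eqP p_le) !mul0n.
  have [q_le|q_lt] := leqP q.2 q.1.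
    by rewrite /d (eqP q_le) !muln0 !mul0n.
  by rewrite leq_mul2l sum_two_edges_le ?orbT.
(* Once the diagonal term [q = p] is split off on both sides, the two sides are equal. *)
rewrite (bigD1 p) //= eqxx.
rewrite [in X in _ <= m * (X + _)](bigD1 p) //=.
under eq_bigr => q qp do rewrite (negPf qp) muln0 addn0 muln1 mulnC.
by rewrite -big_distrr /=; apply: eq_leq; ring.
Qed.

(** In 6 S = (2n-1) 2n (2n+1) the factor 2n - 1, positive for [0 < n], cancels against the one in
    [sum_total_length]. *)
Lemma mul6_sum_total_length n : 0 < n ->
  6 * (\sum_(M in matchings n) total_length M)
  = #|matchings n| * (n.*2 * n.*2.+1).
Proof.
move=> n_gt0; apply/eqP; rewrite -(@eqn_pmul2l (n.*2 - 1)); last by lia.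
apply/eqP; rewrite mulnCA sum_total_length mulnCA mul6_bin3 -subn1.
by rewrite [RHS]mulnCA !mulnA.
Qed.

(** * Expectation and second moment of the average *)

Local Open Scope ring_scope.

Lemma sockuence_averageE (R : realType) n (M : {set {set 'I_n.*2}}) :
  M \in matchings n -> sockuence_average R M = (total_length M)%:R / n.*2%:R.
Proof.
by move=> Mm; rewrite /sockuence_average -sum_sockuence // natr_sum.
Qed.

Lemma matchings_neq0 (R : realType) n : #|matchings n|%:R != 0 :> R.
Proof. by rewrite pnatr_eq0 -lt0n matchings_gt0. Qed.

Lemma expectation_average (R : realType) n : (0 < n)%N ->
  matching_expectation (fun M : {set {set 'I_n.*2}} => sockuence_average R M)
  = n.*2.+1%:R / 6.
Proof.
move=> n_gt0; rewrite /matching_expectation.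
rewrite (eq_bigr _ (fun M => @sockuence_averageE R n M)) -mulr_suml -natr_sum.
have n2_neq0 : n.*2%:R != 0 :> R by rewrite pnatr_eq0 double_eq0 -lt0n.
have := congr1 (fun k => k%:R : R) (mul6_sum_total_length n_gt0).
rewrite !natrM => E.
apply: (mulfI (_ : 6%:R != 0)); first by rewrite pnatr_eq0.
rewrite 2!mulrA E; field.
by rewrite n2_neq0 matchings_neq0.
Qed.

Lemma second_moment_average_le (R : realType) n : (1 < n)%N ->
  matching_expectation
    (fun M : {set {set 'I_n.*2}} => (sockuence_average R M - n%:R / 3) ^+ 2)
  <= 2 * n%:R.
Proof.
move=> n_gt1.
have n_gt0 : (0 < n)%N by lia.
set x : R := n%:R.
have x_ge2 : 2 <= x by rewrite ler_nat.
have m_gt0 : 0 < #|matchings n|%:R :> R by rewrite ltr0n matchings_gt0.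
have n2E : n.*2%:R = 2 * x by rewrite -muln2 natrM mulrC.
have E1 := expectation_average R n_gt0.
pose E2 := matching_expectation
  (fun M : {set {set 'I_n.*2}} => sockuence_average R M ^+ 2).
(* The bound on E L^2 divided by (2n)^2, with S in closed form; the last factor is (2x-1)(2x+1) +
   6(2x-3). Since [1 < n], the subtraction in [n.*2 - 3] is not truncated. *)
have E2_le : 36 * (2 * x - 3) * E2
    <= (2 * x + 1) * ((2 * x) ^+ 2 + 6 * (2 * x) - 19).
  move: (mul6_bin3 n.*2) (sum_total_length_sqr_le n).
  move: 'C(_, _) => k /(congr1 (fun i => i%:R : R)).
  rewrite -subn1 !natrM natrB -?[n.*2.+1%:R]natr1 ?n2E; last lia.
  move=> kE.
  rewrite -(ler_nat R) !(natrM, natrD, natrX) !natrB; [|lia..].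
  have -> : (\sum_(M in matchings n) total_length M ^ 2)%N%:R
      = E2 * #|matchings n|%:R * (2 * x) ^+ 2.
    rewrite /E2 /matching_expectation divfK ?matchings_neq0 // natr_sum mulr_suml.
    apply: eq_bigr => M Mm; rewrite sockuence_averageE // n2E natrX.
    rewrite exprMn exprVn divfK // expf_neq0 //; lra.
  rewrite n2E.
  have -> : k%:R = (2 * x - 1) * (2 * x) * (2 * x + 1) / 6 by lra.
  set y := E2; set m := #|_|%:R => H.
  have k_gt0 : 0 < m * (2 * x) ^+ 2 * (2 * x - 1).
    by rewrite !mulr_gt0 // ?exprn_gt0; lra.
  rewrite -(ler_pM2l k_gt0).
  by lra.
(* Expand the square by linearity and insert the exact expectation (2x+1)/6. *)
have -> : matching_expectation
    (fun M : {set {set 'I_n.*2}} => (sockuence_average R M - x / 3) ^+ 2)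
    = E2 - 2 * (x / 3) * ((2 * x + 1) / 6) + (x / 3) ^+ 2.
  have -> : 2 * x + 1 = n.*2.+1%:R by rewrite -n2E natr1.
  rewrite -E1 /E2 /matching_expectation.
  rewrite (eq_bigr (fun M => sockuence_average R M ^+ 2
    - 2 * (x / 3) * sockuence_average R M + (x / 3) ^+ 2)); last first.
    by move=> M _; ring.
  rewrite big_split sumrB /= -mulr_sumr sumr_const -[_ *+ _]mulr_natl; field.
  exact: matchings_neq0.
(* After multiplication by 36(2x-3) > 0 the cubic terms cancel, and 112x^2 - 202x + 19 >= 0 is left,
   which holds for x >= 2. *)
nra.
Qed.

(** * Chebyshev's inequality and concentration *)

(** Each matching with |f M - c| > t contributes at least t^2 to the sum of squares. The centre [c]
    is arbitrary, so n/3 can be used in place of the mean. *)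
Lemma chebyshev_matching (R : realType) n (f : {set {set 'I_n.*2}} -> R) c t :
  0 < t ->
  1 - matching_prob R (fun M : {set {set 'I_n.*2}} => `|f M - c| <= t)
  <= matching_expectation (fun M => (f M - c) ^+ 2) / t ^+ 2.
Proof.
move=> t_gt0; rewrite ler_pdivlMr ?exprn_gt0 //.
have m_gt0 : 0 < #|matchings n|%:R :> R by rewrite ltr0n matchings_gt0.
rewrite -(ler_pM2r m_gt0) /matching_expectation divfK ?gt_eqF //.
rewrite /matching_prob mulrAC mulrBl mul1r divfK ?gt_eqF //.
rewrite -!sum1_card !natr_sum [X in _ - X]big_mkcond [X in X - _]big_mkcond /=.
rewrite -sumrB mulr_suml [leRHS]big_mkcond; apply: ler_sum => M _.
rewrite !inE; case: (is_matching M) => /=; last by rewrite subrr mul0r.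
have [_|t_lt] := leP `|f M - c| t;
  first by rewrite subrr mul0r sqr_ge0.
rewrite subr0 mul1r -[leRHS]real_normK ?num_real //.
by rewrite ler_pXn2r ?nnegrE ?normr_ge0 // ltW.
Qed.

Lemma matching_prob_le1 (R : realType) n (A : pred {set {set 'I_n.*2}}) :
  matching_prob R A <= 1.
Proof.
rewrite /matching_prob ler_pdivrMr ?ltr0n ?matchings_gt0 // mul1r ler_nat.
by apply/subset_leq_card/fintype.subsetP => M; rewrite inE => /andP[].
Qed.

Local Open Scope classical_set_scope.
Local Open Scope ring_scope.

Theorem theorem1p1 (R : realType) :
  (forall n : nat, (1 <= n)%N ->
     matching_expectation (fun M : {set {set 'I_n.*2}} =>
       sockuence_average R M) = (n.*2.+1)%:R / 6%:R) /\
  (forall omega : nat -> R,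
     omega n @[n --> \oo] --> +oo ->
     matching_prob R (fun M : {set {set 'I_n.*2}} =>
       `|sockuence_average R M - n%:R / 3%:R| <= omega n * Num.sqrt n%:R)
     @[n --> \oo] --> (1 : R)).
Proof.
split=> [n n_ge1|omega omega_pinfty]; first exact: expectation_average.
apply/cvgrPdist_le => e e_gt0; near=> n.
have n_gt1 : (1 < n)%N by near: n; exact: nbhs_infty_gt.
(* Chebyshev bounds the failure probability by 2n / (omega^2 n) = 2 / omega^2. The summand 1 gives
   omega^2 >= omega, and omega >= 2/e then makes this at most [e]. *)
have omega_ge : 1 + 2 / e <= omega n by near: n; exact: cvgry_ge omega_pinfty _.
have e'_gt0 : 0 < 2 / e by rewrite divr_gt0.
have x_gt0 : 0 < n%:R :> R by rewrite ltr0n; apply: ltnW.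
have t_gt0 : 0 < omega n * Num.sqrt n%:R.
  by rewrite mulr_gt0 ?sqrtr_gt0 //; lra.
rewrite ger0_norm ?subr_ge0 ?matching_prob_le1 //.
apply: le_trans (chebyshev_matching _ _ t_gt0) _.
rewrite exprMn sqr_sqrtr ?ler0n // ler_pdivrMr; last first.
  by rewrite mulr_gt0 ?exprn_gt0 //; lra.
apply: le_trans (second_moment_average_le R n_gt1) _.
rewrite mulrA ler_pM2r //.
have -> : 2 = e * (2 / e) :> R by field; rewrite gt_eqF.
rewrite ler_pM2l //; nra.
Unshelve. all: by end_near. Qed.
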